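(* For every $n\geq 2$, the $2$-token graph $T_2(K_n)$ of the complete graph $K_n$ is well-covered.
   Context: The $2$-token graph $T_2(G)$ has as vertices the $2$-subsets of $V(G)$, two of them adjacent if their symmetric difference is an edge of $G$. A graph is well-covered if all of its maximal (with respect to inclusion) independent sets have the same cardinality. *)

(* Defs.v *)
From mathcomp Require Import all_boot.
Set Implicit Arguments.
Unset Strict Implicit.
Unset Printing Implicit Defensive.

Record sgraph := SGraph {
  vertex :> finType;
  adj : rel vertex;
  adj_sym : symmetric adj;
  adj_irrefl : irreflexive adj
}.

Definition is_edge (G : sgraph) (e : {set G}) : bool :=
  [exists x : G, exists y : G, adj x y && (e == [set x; y])].

Definition independent (G : sgraph) (S : {set G}) : bool :=
  [forall x in S, forall y in S, ~~ adj x y].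

Definition well_covered (G : sgraph) : Prop :=
  forall S T : {set G},
    maxset (@independent G) S -> maxset (@independent G) T -> #|S| = #|T|.

Section Complete.
Variable n : nat.

Definition complete_adj : rel 'I_n := fun x y => x != y.

Lemma complete_adj_sym : symmetric complete_adj.
Proof. by move=> x y; rewrite /complete_adj eq_sym. Qed.

Lemma complete_adj_irrefl : irreflexive complete_adj.
Proof. by move=> x; rewrite /complete_adj eqxx. Qed.

Definition complete_graph : sgraph :=
  SGraph complete_adj_sym complete_adj_irrefl.
End Complete.

Definition symdiff (T : finType) (A B : {set T}) : {set T} :=
  (A :\: B) :|: (B :\: A).

Section Token.
Variable G : sgraph.

Definition token2_vertex := {A : {set G} | #|A| == 2}.

Definition token2_adj : rel token2_vertex :=
  fun A B => is_edge (symdiff (val A) (val B)).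

Lemma token2_adj_sym : symmetric token2_adj.
Proof. by move=> A B; rewrite /token2_adj /symdiff setUC. Qed.

Lemma token2_adj_irrefl : irreflexive token2_adj.
Proof.
move=> A; rewrite /token2_adj /symdiff setDv setU0 /is_edge.
apply/negbTE/negP=> /existsP[x /existsP[y /andP[_ /eqP/setP/(_ x)]]].
by rewrite !inE eqxx.
Qed.

Definition token2_graph : sgraph :=
  SGraph token2_adj_sym token2_adj_irrefl.
End Token.

(* Main.v *)
Require Import Defs.
From mathcomp Require Import all_boot zify.

(** Two 2-subsets are adjacent in [T_2(K_n)] exactly when they meet in one
    point, so independent sets are matchings of [K_n].  A maximal matching
    leaves at most one vertex uncovered and therefore has [n./2] edges. *)

Lemma card_symdiff (T : finType) (A B : {set T}) :
  #|symdiff A B| + #|A :&: B|.*2 = #|A| + #|B|.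
Proof.
have dis : [disjoint A :\: B & B :\: A].
  rewrite -setI_eq0; apply/eqP/setP=> x; rewrite !inE.
  by case: (x \in A); case: (x \in B).
have := (leq_card_setU (A :\: B) (B :\: A)).2; rewrite dis => /eqP cardU.
rewrite /symdiff cardU -(cardsID B A) -(cardsID A B) (setIC B A); lia.
Qed.

Lemma is_edge_complete (n : nat) (e : {set complete_graph n}) :
  is_edge e = (#|e| == 2).
Proof.
apply/idP/cards2P.
  by move=> /existsP[x /existsP[y /andP[xy /eqP->]]]; exists x, y.
move=> [x [y [xy ->]]]; apply/existsP; exists x; apply/existsP; exists y.
by rewrite eqxx andbT.
Qed.

(** Distinct 2-subsets share 0 or 1 points, so their symmetric difference has 4 or 2 elements, and
    only size 2 is an edge of [complete_graph n]. Distinctness matters: a vertex is neither adjacent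
    to nor disjoint from itself. *)
Lemma token2_complete_adjN (n : nat) (A B : token2_graph (complete_graph n)) :
  A != B -> ~~ adj A B = [disjoint val A & val B].
Proof.
move=> neqAB; rewrite /= /token2_adj is_edge_complete -setI_eq0 -cards_eq0.
(* An intersection of size 2 would fill both [A] and [B], making them equal. *)
have cI : #|val A :&: val B| != 2.
  apply: contra neqAB => /eqP cI; apply/eqP/val_inj.
  have eqI (C : {set complete_graph n}) : #|C| == 2 ->
      val A :&: val B \subset C -> val A :&: val B = C.
    by move=> /eqP cC sIC; apply/eqP; rewrite eqEcard sIC cC cI.
  by rewrite -(eqI _ (valP A) (subsetIl _ _)) (eqI _ (valP B) (subsetIr _ _)).
have := card_symdiff _ (val A) (val B).
rewrite (eqP (valP A)) (eqP (valP B)); move: cI.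
by move: #|symdiff _ _| #|_ :&: _| => s c; lia.
Qed.

Section MaximalMatching.

Variables (n : nat) (S : {set token2_graph (complete_graph n)}).

Let covered : {set complete_graph n} := cover (val @: S).

(** The members of [S] are pairwise disjoint, so their sizes, all 2, add up in the union. *)
Lemma independent_card_cover : independent S -> #|covered| = #|S|.*2.
Proof.
move=> indS; have triv : trivIset (val @: S).
  apply/trivIsetP=> _ _ /imsetP[A AS ->] /imsetP[B BS ->] neqAB.
  have {}neqAB : A != B by apply: contra neqAB => /eqP->.
  rewrite -token2_complete_adjN //.
  by have /forall_inP/(_ A AS)/forall_inP/(_ B BS) := indS.
rewrite /covered -(eqP triv) (eq_bigr (fun=> 2)).
  by rewrite sum_nat_const card_imset ?muln2 //; apply: val_inj.
by move=> _ /imsetP[A _ ->]; apply/eqP/(valP A).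
Qed.

(** Two uncovered points would form an edge disjoint from every member of [S], which could then be
    added to [S]. *)
Lemma maximal_independent_uncovered :
  maxset (@independent _) S -> #|~: covered| <= 1.
Proof.
move=> /maxsetP[indS maxS]; rewrite leqNgt; apply/negP=> /card_gt1P[x [y []]].
rewrite !inE => xS yS neqxy.
have cxy : #|[set x; y]| == 2 by rewrite cards2 neqxy.
pose E : token2_graph (complete_graph n) := Sub [set x; y] cxy.
have disE A : A \in S -> ~~ adj A E.
  move=> AS.
  have sub z : z \in val A -> z \in covered.
    by move=> zA; apply/bigcupP; exists (val A) => //; apply: imset_f.
  have disAE : [disjoint val A & val E].
    rewrite -setI_eq0; apply/eqP/setP=> z; rewrite !inE.
    apply/andP=> -[/sub zS /orP[]] /eqP zE; move: zS; rewrite zE.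
      exact/negP.
    exact/negP.
  (* What remains is [A != E]: otherwise the nonempty set [[set x; y]] would be disjoint from
     itself. *)
  rewrite token2_complete_adjN //; apply: contraTneq disAE => ->.
  by rewrite -setI_eq0 setIid -cards_eq0 (eqP cxy).
have indU : independent (E |: S).
  apply/forall_inP=> A AU; apply/forall_inP=> B; move: AU.
  rewrite !inE => /orP[/eqP->|AS] /orP[/eqP->|BS].
  - by rewrite adj_irrefl.
  - by rewrite adj_sym disE.
  - exact: disE.
  - by have /forall_inP/(_ A AS)/forall_inP/(_ B BS) := indS.
(* Maximality puts [E] in [S], so [x] is covered after all. *)
have ES : E \in S by rewrite -(maxS _ indU (subsetUr _ _)) setU11.
case/negP: xS; apply/bigcupP; exists (val E); first exact: imset_f.
by rewrite !inE eqxx.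
Qed.

(** Here [n] is twice [#|S|] plus a remainder of at most 1, the number of uncovered points; this
    fixes [#|S|] for either parity of [n]. *)
Lemma maximal_independent_card : maxset (@independent _) S -> #|S| = n./2.
Proof.
move=> maxS; have cS := independent_card_cover (maxsetp maxS).
have := maximal_independent_uncovered maxS.
have := cardsC covered; rewrite cS card_ord; lia.
Qed.

End MaximalMatching.

Theorem theorem6p1 (n : nat) (hn : 2 <= n) :
  well_covered (token2_graph (complete_graph n)).
Proof.
by move=> S T maxS maxT; rewrite !maximal_independent_card.
Qed.
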